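(* Let $M$ be a $d\times d$ dilation matrix with $\|M^{-1}\|<1$. Suppose that the mask $\{c_q\}_{q\in\mathbb{Z}^d}$ has finite support and satisfies $\sum_{q\in\mathbb{Z}^d}c_q=1$. Let $\phi$ be the corresponding limit (scaling) function. Then $$\operatorname{supp}\phi\subset\left\{x\in\mathbb{R}^d:\ |x|\le\frac{Q\,\|M^{-1}\|}{1-\|M^{-1}\|}\right\},$$ where $Q:=\max_{q\in\Omega}|q|$ and $\Omega:=\{q\in\mathbb{Z}^d: c_q\neq 0\}$.
   Context: A dilation matrix is a $d\times d$ integer matrix all of whose eigenvalues have modulus greater than $1$; put $m:=|\det M|$. The norm of a matrix is the operator norm from $\mathbb{R}^d$ to $\mathbb{R}^d$ with respect to the Euclidean norm $|\cdot|$. A mask is a family of coefficients $\{c_q\}_{q\in\mathbb{Z}^d}$. $S'$ denotes the space of tempered distributions on $\mathbb{R}^d$. For a finitely supported mask with $\sum_q c_q=1$, the scaling equation $$\phi(x)=m\sum_{q\in\mathbb{Z}^d}c_q\,\phi(Mx-q),\qquad x\in\mathbb{R}^d$$ (understood in the sense of distributions) has a compactly supported solution $\phi\in S'$, unique up to a constant factor; $\phi$ denotes this solution normalized by $\widehat\phi(0)=1$, that is, $\widehat\phi(u)=\prod_{j=1}^\infty m_0((M^* )^{-j}u)$ with $m_0(u)=\sum_q c_q e^{-2\pi i(q,u)}$ and $M^*$ the adjoint of $M$. It is called the limit function (or scaling function), since it is the limit in $S'$ of $T_c^nF_0$ as $n\to\infty$, where $(T_cf)(x)=m\sum_q c_qf(Mx-q)$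 is the cascade operator and $F_0$ is any piecewise continuous compactly supported function with $\sum_{q\in\mathbb{Z}^d}F_0(x+q)=1$ and $\widehat F_0(0)=1$. The support is that of a distribution. *)

(* Defs.v *)
(* MathComp / MathComp-Analysis *)
From HB Require Import structures.
From mathcomp Require Import all_boot all_order all_algebra.
From mathcomp Require Import all_classical all_reals all_analysis.
From mathcomp Require Import finmap complex.
Set Implicit Arguments.
Unset Strict Implicit.
Unset Printing Implicit Defensive.
Import Order.TTheory GRing.Theory Num.Theory.
Import numFieldNormedType.Exports.
Local Open Scope classical_set_scope.
Local Open Scope ring_scope.
Local Open Scope complex_scope.

Section Euclidean.
Context {R : realType} {d : nat}.
Implicit Types x y : 'cV[R]_d.

Definition edot x y : R := \sum_(i < d) x i 0 * y i 0.

(* The library's own norm on matrices is the sup norm; it is only used here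
   through its topology, which is the usual one of R^d. *)
Definition enorm x : R := Num.sqrt (edot x x).

Definition opnorm (A : 'M[R]_d) : R :=
  sup [set enorm (A *m x) | x in [set x | enorm x <= 1]].

End Euclidean.

Section TemperedDistributions.
Context {R : realType} {d : nat}.
Local Notation V := 'cV[R]_d.
Local Notation C := R[i].
Implicit Types (f : V -> R) (psi chi : V -> C).

Definition cmod (z : C) : R := Num.sqrt (complex.Re z ^+ 2 + complex.Im z ^+ 2).

(* A partial derivative of order [size s] is indexed by the sequence [s] of
   the coordinates along which one differentiates. *)
Definition partial_real (s : seq 'I_d) f : V -> R :=
  foldr (fun i g => 'D_(delta_mx i 0) g) f s.

Definition partial (s : seq 'I_d) psi : V -> C := fun x =>
  partial_real s (fun y => complex.Re (psi y)) x
  +i* partial_real s (fun y => complex.Im (psi y)) x.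

Definition smooth_real f : Prop :=
  forall (s : seq 'I_d) (x : V), differentiable (partial_real s f) x.

Definition smooth psi : Prop :=
  smooth_real (fun y => complex.Re (psi y)) /\
  smooth_real (fun y => complex.Im (psi y)).

(* All Schwartz seminorms of index at most [N] are bounded by [B]. *)
Definition seminorms_le (N : nat) (B : R) psi : Prop :=
  forall (s : seq 'I_d) (x : V), (size s <= N)%N ->
    (1 + enorm x) ^+ N * cmod (partial s psi x) <= B.

Definition schwartz psi : Prop :=
  smooth psi /\ forall N : nat, exists B : R, seminorms_le N B psi.

(* Functionals are defined on all functions; only their values on Schwartz
   functions are meaningful. *)
Definition functional := (V -> C) -> C.
Implicit Types T : functional.

Definition linear_on_schwartz T : Prop :=
  forall (a : C) psi1 psi2, schwartz psi1 -> schwartz psi2 ->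
    T (fun x => a * psi1 x + psi2 x) = a * T psi1 + T psi2.

(* Continuity for the locally convex topology of the Schwartz seminorms. *)
Definition continuous_on_schwartz T : Prop :=
  forall psi0, schwartz psi0 -> forall eps : R, 0 < eps ->
  exists (N : nat) (delta : R), 0 < delta /\
    forall psi, schwartz psi ->
      seminorms_le N delta (fun x => psi x - psi0 x) ->
      cmod (T psi - T psi0) < eps.

Definition tempered T : Prop :=
  linear_on_schwartz T /\ continuous_on_schwartz T.

Definition fsupp psi : set V := closure [set x | psi x != 0].

Definition test_function psi : Prop := smooth psi /\ compact (fsupp psi).

Definition vanishes_on T (U : set V) : Prop :=
  forall psi, test_function psi -> fsupp psi `<=` U -> T psi = 0.

Definition dsupp T : set V :=
  ~` \bigcup_(U in [set U | open U /\ vanishes_on T U]) U.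

(* The distribution x |-> T(Ax - b), for invertible [A]: change of variables
   y = Ax - b in the pairing with a Schwartz function. *)
Definition affine_pullback (A : 'M[R]_d) (b : V) T : functional := fun psi =>
  (`|\det A|^-1)%:C * T (fun y => psi (invmx A *m (y + b))).

(* Fourier transform at [u] of a compactly supported distribution: its pairing
   with x |-> e^{-2 pi i (u,x)}, cut off by any test function equal to 1 on a
   neighbourhood of the support. *)
Definition fourier_at T (u : V) (z : C) : Prop :=
  forall (chi : V -> C) (U : set V), test_function chi ->
    open U -> dsupp T `<=` U -> (forall x, U x -> chi x = 1) ->
    T (fun x => chi x * (cos (2 * pi * edot u x) -i* sin (2 * pi * edot u x)))
    = z.

End TemperedDistributions.

Section Refinement.
Context {R : realType} {d : nat}.
Implicit Types (M : 'M[int]_d) (c : 'cV[int]_d -> R[i]).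

Definition dilation_matrix M : Prop :=
  forall lambda : R[i],
    eigenvalue (map_mx intr M : 'M[R[i]]_d) lambda -> 1 < `|lambda|.

Definition mask_support c : set 'cV[int]_d := [set q | c q != 0].

(* For a mask of finite support; the norms are nonnegative, so starting the
   maximum at 0 is harmless. *)
Definition mask_radius c : R :=
  \big[Num.max/0]_(q <- fset_set (mask_support c)) enorm (map_mx intr q).

Definition scaling_equation M c (phi : functional) : Prop :=
  let MR : 'M[R]_d := map_mx intr M in
  forall psi : 'cV[R]_d -> R[i], schwartz psi ->
    phi psi = `|\det MR|%:C *
      \sum_(q \in [set: 'cV[int]_d])
        c q * affine_pullback MR (map_mx intr q) phi psi.

Definition limit_function M c (phi : functional) : Prop :=
  [/\ tempered phi, compact (dsupp phi), scaling_equation M c phi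
    & fourier_at phi 0 1].

End Refinement.

Arguments dilation_matrix R {d} M.

(* Main.v *)
Require Import Defs.
From mathcomp Require Import all_boot all_order all_algebra.
From mathcomp Require Import all_classical all_reals all_analysis.
From mathcomp Require Import complex.
From mathcomp Require Import lra.
Import Order.TTheory GRing.Theory Num.Theory.
Import numFieldNormedType.Exports.
Local Open Scope classical_set_scope.
Local Open Scope ring_scope.

(** Write [K] for the support of [phi], [nu] for the norm of [M^-1] and [Q] for
    the radius of the mask. The scaling equation forces
    [K `<=` \bigcup_q M^-1 (K + q)], the union being over the [q] with
    [c q != 0] ([dsupp_scaling_equation]). As [K] is compact, it is empty or has
    a point [x0] of greatest norm; such a point is [M^-1 (y + q)] for some [y]
    in [K], so [|x0| <= nu (|y| + Q) <= nu (|x0| + Q)], that is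
    [|x0| <= Q nu / (1 - nu)], and every other point of [K] is no farther from
    the origin.

    The inclusion is a matter of transporting test functions. Composing one
    with an invertible affine map gives a test function again
    ([test_function_affine]), by an iterated chain rule for partial
    derivatives; and test functions are Schwartz functions
    ([test_function_schwartz]), so that the scaling equation, which is stated
    for the latter, applies to them. *)

(** * The Euclidean norm and the operator norm *)

Section EuclideanNorm.
Set Implicit Arguments.
Unset Strict Implicit.
Context {R : realType} {d : nat}.
Implicit Types (x y : 'cV[R]_d) (A : 'M[R]_d).

Lemma edotC x y : edot x y = edot y x.
Proof. by apply: eq_bigr => i _; rewrite mulrC. Qed.

Lemma edotDl x y z : edot (x + y) z = edot x z + edot y z.
Proof. by rewrite -big_split; apply: eq_bigr => i _; rewrite mxE mulrDl. Qed.

Lemma edotZl a x y : edot (a *: x) y = a * edot x y.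
Proof. by rewrite [RHS]mulr_sumr; apply: eq_bigr => i _; rewrite mxE mulrA. Qed.

Lemma edot_ge0 x : 0 <= edot x x.
Proof. by apply: sumr_ge0 => i _; rewrite -expr2 sqr_ge0. Qed.

Lemma edot_eq0 x : edot x x = 0 -> x = 0.
Proof.
move=> /eqP; rewrite psumr_eq0 => [/allP h|i _]; last by rewrite -expr2 sqr_ge0.
apply/colP => i; rewrite mxE.
by have := h i (mem_index_enum i); rewrite /= mulf_eq0 orbb => /eqP.
Qed.

Lemma edot_CauchySchwarz x y : edot x y ^+ 2 <= edot x x * edot y y.
Proof.
have [y0|y0] := eqVneq (edot y y) 0.
  rewrite y0 mulr0 (edot_eq0 y0) edotC /edot big1 ?expr0n // => i _.
  by rewrite mxE mul0r.
have yp : 0 < edot y y by rewrite lt0r y0 edot_ge0.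
(* the squared length of the component of [x] orthogonal to [y], up to scale *)
have := edot_ge0 (edot y y *: x + (- edot x y) *: y).
rewrite !(edotDl, edotZl) ![edot _ (_ + _)]edotC !(edotDl, edotZl) (edotC y x).
by move=> h; rewrite -subr_ge0 -(pmulr_rge0 _ yp); lra.
Qed.

Lemma enorm_ge0 x : 0 <= enorm x.
Proof. exact: sqrtr_ge0. Qed.

Lemma sqr_enorm x : enorm x ^+ 2 = edot x x.
Proof. exact: sqr_sqrtr (edot_ge0 x). Qed.

Lemma enorm_eq0 x : enorm x = 0 -> x = 0.
Proof. by move=> x0; apply: edot_eq0; rewrite -sqr_enorm x0 expr0n. Qed.

Lemma enormZ a x : 0 <= a -> enorm (a *: x) = a * enorm x.
Proof.
move=> a0; rewrite /enorm edotZl edotC edotZl mulrA -expr2.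
by rewrite sqrtrM ?sqr_ge0 // sqrtr_sqr ger0_norm.
Qed.

Lemma enormD x y : enorm (x + y) <= enorm x + enorm y.
Proof.
have xy0 : 0 <= enorm x + enorm y by rewrite addr_ge0 ?enorm_ge0.
rewrite -(@ler_pXn2r _ 2) ?nnegrE ?enorm_ge0 // sqrrD !sqr_enorm.
rewrite !edotDl ![edot _ (_ + _)]edotC !edotDl (edotC y x).
suff : edot x y <= enorm x * enorm y by lra.
apply: le_trans (ler_norm _) _.
rewrite -(@ler_pXn2r _ 2) ?nnegrE ?mulr_ge0 ?enorm_ge0 //.
by rewrite exprMn !sqr_enorm real_normK ?num_real // edot_CauchySchwarz.
Qed.

Lemma enorm_continuous : continuous (@enorm R d).
Proof.
move=> x; apply: (@continuous_comp _ _ _ (fun x => edot x x) Num.sqrt); last first.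
  exact: sqrt_continuous.
apply: (@differentiable_continuous R).
have -> : (fun x => edot x x) =
    \sum_(i < d) (fun x : 'cV[R]_d => x i 0 * x i 0).
  by apply/funext => y; rewrite fct_sumE.
apply: differentiable_sum => i.
by apply: differentiableM; exact: differentiable_coord.
Qed.

(** The Hilbert-Schmidt norm dominates the operator norm; this makes the
    supremum that defines [opnorm] a genuine one. *)
Lemma opnorm_has_ubound A :
  has_ubound [set enorm (A *m x) | x in [set x | enorm x <= 1]].
Proof.
exists (Num.sqrt (\sum_(i < d) edot (row i A)^T (row i A)^T)) => _ [x /= x1 <-].
rewrite ler_sqrt; last by apply: sumr_ge0 => i _; exact: edot_ge0.
apply: ler_sum => i _; rewrite -expr2.
have -> : (A *m x) i 0 = edot (row i A)^T x.
  by rewrite mxE; apply: eq_bigr => j _; rewrite !mxE.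
apply: le_trans (edot_CauchySchwarz _ _) _.
by rewrite ler_piMr ?edot_ge0 // -sqr_enorm expr_le1 ?enorm_ge0.
Qed.

Lemma opnorm_ge0 A : 0 <= opnorm A.
Proof.
apply: le_trans (enorm_ge0 (A *m 0)) (ub_le_sup (opnorm_has_ubound A) _).
exists 0 => //=; rewrite /enorm /edot big1 ?sqrtr0 // => i _.
by rewrite mxE mul0r.
Qed.

Lemma enorm_mulmx A x : enorm (A *m x) <= opnorm A * enorm x.
Proof.
have [x0|x0] := eqVneq (enorm x) 0.
  rewrite x0 mulr0 (enorm_eq0 x0) mulmx0.
  by rewrite -[0 : 'cV_d](scale0r (0 : 'cV_d)) enormZ // mul0r.
have xp : 0 < enorm x by rewrite lt0r x0 enorm_ge0.
rewrite -ler_pdivrMr //.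
have xi0 : 0 <= (enorm x)^-1 by rewrite invr_ge0 enorm_ge0.
rewrite mulrC -enormZ // scalemxAr.
apply: (ub_le_sup (opnorm_has_ubound A)).
by exists ((enorm x)^-1 *: x) => //=; rewrite enormZ // mulVf.
Qed.

End EuclideanNorm.

(** * Test functions and affine changes of variables *)

Section SmoothFunctions.
Set Implicit Arguments.
Unset Strict Implicit.
Context {R : realType} {d : nat}.
Local Notation V := 'cV[R]_d.
Implicit Types (f : V -> R) (psi : V -> R[i]) (A : 'M[R]_d) (b : V).

Lemma affine_differentiable A b x :
  differentiable (fun y : V => A *m (y + b)) x.
Proof.
have -> : (fun y : V => A *m (y + b)) =
    (\sum_(j < d) (fun y : V => y j 0 *: col j A)) + cst (A *m b).
  apply/funext => y; rewrite mulmxDr; congr (_ + _).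
  rewrite fct_sumE; apply/colP => i; rewrite summxE mxE.
  by apply: eq_bigr => j _; rewrite !mxE mulrC.
apply: differentiableD => //.
apply: differentiable_sum => j; apply: differentiableZl.
exact: differentiable_coord.
Qed.

Lemma affine_continuous A b : continuous (fun y : V => A *m (y + b)).
Proof.
by move=> x; apply: differentiable_continuous; exact: affine_differentiable.
Qed.

Lemma derive_affine A b f i x : differentiable f (A *m (x + b)) ->
  'D_(delta_mx i 0) (fun y => f (A *m (y + b))) x =
  \sum_(j < d) A j i * 'D_(delta_mx j 0) f (A *m (x + b)).
Proof.
move=> df.
(* both sides are limits of the very same difference quotient *)
have -> : 'D_(delta_mx i 0) (fun y => f (A *m (y + b))) x =
    'D_(A *m delta_mx i 0) f (A *m (x + b)).
  rewrite /derive; under [in LHS]eq_fun => h.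
    by rewrite /= -addrA mulmxDr -scalemxAr; over.
  by [].
rewrite deriveE // -colE.
have -> : col i A = \sum_(j < d) A j i *: delta_mx j 0.
  by rewrite [LHS]matrix_sum_delta; apply: eq_bigr => j _; rewrite big_ord1 mxE.
by rewrite linear_sum; apply: eq_bigr => j _; rewrite linearZ deriveE.
Qed.

(** The list [l] is a formal constant-coefficient differential operator:
    these functions form a class that contains [f o A] and, by the chain rule,
    is stable under differentiation. *)
Definition affine_pullback_sum A b f (l : seq (R * seq 'I_d)) : V -> R :=
  fun x => \sum_(p <- l) p.1 * partial_real p.2 f (A *m (x + b)).

Lemma affine_pullback_sum_differentiable A b f l x : smooth_real f ->
  differentiable (affine_pullback_sum A b f l) x.
Proof.
move=> sf.
have -> : affine_pullback_sum A b f l = \sum_(i < size l)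
    (fun x => (tnth (in_tuple l) i).1 *
       partial_real (tnth (in_tuple l) i).2 f (A *m (x + b))).
  by apply/funext => y; rewrite fct_sumE /affine_pullback_sum big_tnth.
apply: differentiable_sum => i; apply: differentiableM => //.
by apply: differentiable_comp; [exact: affine_differentiable|exact: sf].
Qed.

(** Since one differentiation in [x] is a combination of differentiations of
    [f] by [derive_affine], [smooth_real f] makes all iterated derivatives of
    [f o A] explicit, hence differentiable. *)
Lemma partial_affine A b f s : smooth_real f -> exists l,
  partial_real s (fun y => f (A *m (y + b))) = affine_pullback_sum A b f l.
Proof.
move=> sf; elim: s => [|i s [l IH]].
  exists [:: (1, [::])]; apply/funext => x.
  by rewrite /affine_pullback_sum big_seq1 mul1r.
rewrite /= -/(partial_real s _) IH.
exists [seq (p.1 * A j i, j :: p.2) | p <- l, j <- enum 'I_d].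
apply/funext => x; rewrite /affine_pullback_sum big_allpairs_dep /=.
elim: l {IH} => [|p l IH].
  by under eq_fun do rewrite big_nil; rewrite big_nil derive_cst.
under eq_fun do rewrite big_cons.
have dp : differentiable
    (fun y => p.1 * partial_real p.2 f (A *m (y + b))) x.
  have := affine_pullback_sum_differentiable A b [:: p] x sf.
  by rewrite /affine_pullback_sum; under eq_fun do rewrite big_seq1.
have dpf : differentiable
    (fun y => partial_real p.2 f (A *m (y + b))) x.
  have := affine_pullback_sum_differentiable A b [:: (1, p.2)] x sf.
  by rewrite /affine_pullback_sum; under eq_fun do rewrite big_seq1 mul1r.
rewrite big_cons -IH deriveD; last first.
- exact/diff_derivable/affine_pullback_sum_differentiable.
- exact: diff_derivable.
congr (_ + _); rewrite deriveMl; last exact: diff_derivable.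
rewrite derive_affine; last exact: sf.
by rewrite mulr_sumr big_enum; apply: eq_bigr => j _; rewrite mulrA.
Qed.

Lemma smooth_real_affine A b f :
  smooth_real f -> smooth_real (fun y => f (A *m (y + b))).
Proof.
move=> sf s x; have [l ->] := partial_affine A b s sf.
exact: affine_pullback_sum_differentiable.
Qed.

Lemma fsupp_affine A b psi :
  fsupp (fun y => psi (A *m (y + b))) `<=`
  (fun y => A *m (y + b)) @^-1` fsupp psi.
Proof.
rewrite [X in _ `<=` X](closure_id _).1; last first.
  apply: closed_comp; last exact: closed_closure.
  by move=> x _; exact: affine_continuous.
by apply: closureS => x /= px; apply: subset_closure.
Qed.

Lemma test_function_affine A b psi : A \in unitmx ->
  test_function psi -> test_function (fun y => psi (A *m (y + b))).
Proof.
move=> uA [[sre sim] cpsi]; split.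
  by split; [exact: smooth_real_affine sre|exact: smooth_real_affine sim].
(* the support is a closed subset of the image of [fsupp psi] under the
   inverse affine map *)
pose g (z : V) : V := invmx A *m (z - A *m b).
apply: (@subclosed_compact _ _ (g @` fsupp psi)).
- exact: closed_closure.
- apply: continuous_compact cpsi.
  exact/continuous_subspaceT/affine_continuous.
- move=> y /fsupp_affine /= hy; exists (A *m (y + b)) => //.
  by rewrite /g -mulmxBr addrK mulKmx.
Qed.

Lemma partial_real_eq0 s f (U : set V) : open U ->
  (forall x, U x -> f x = 0) -> forall x, U x -> partial_real s f x = 0.
Proof.
move=> oU f0; elim: s => [|i s IH] x Ux; first exact: f0.
rewrite /=.
have <- : 'D_(delta_mx i 0) (cst (0 : R) : V -> R) x = 0 by exact: derive_cst.
apply: near_eq_derive; near=> y; apply: IH.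
by near: y; exact: open_nbhs_nbhs.
Unshelve. all: by end_near. Qed.

Lemma partial_eq0 s psi x : ~ fsupp psi x -> partial s psi x = 0.
Proof.
have oU : open (~` fsupp psi) by apply: closed_openC; exact: closed_closure.
have psi0 y : (~` fsupp psi) y -> psi y = 0.
  by move=> ny; apply: contra_notP ny => /eqP py; apply: subset_closure.
by move=> nx; rewrite /partial
  !(@partial_real_eq0 s _ _ oU) // => y /psi0 ->.
Qed.

Lemma cmod_ge0 (z : R[i]) : 0 <= cmod z.
Proof. exact: sqrtr_ge0. Qed.

Lemma cmod_partial_continuous s psi : smooth psi ->
  continuous (fun x => cmod (partial s psi x)).
Proof.
move=> [sre sim] x.
pose g y := partial_real s (fun z => complex.Re (psi z)) y ^+ 2 +
            partial_real s (fun z => complex.Im (psi z)) y ^+ 2.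
apply: (@continuous_comp _ _ _ g Num.sqrt); last exact: sqrt_continuous.
apply: (@differentiable_continuous R).
by apply: differentiableD;
  [exact: (differentiableX 1 (sre s x))|exact: (differentiableX 1 (sim s x))].
Qed.

(** Each weighted derivative is continuous and vanishes off the compact
    support, hence is bounded; a seminorm involves finitely many of them. *)
Lemma test_function_schwartz psi : test_function psi -> schwartz psi.
Proof.
move=> [spsi cpsi]; split=> // N.
pose w s x := (1 + enorm x) ^+ N * cmod (partial s psi x).
have w_ge0 s x : 0 <= w s x.
  by rewrite mulr_ge0 ?cmod_ge0 // exprn_ge0 // addr_ge0 ?enorm_ge0.
have w_bounded s : exists B : R, 0 <= B /\ forall x, w s x <= B.
  have cw : continuous (w s).
    move=> x; apply: (@continuousM R _ (fun x => (1 + enorm x) ^+ N)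
      (fun x => cmod (partial s psi x))); last exact: cmod_partial_continuous.
    apply: (@continuous_comp _ _ _ (fun x => 1 + enorm x) (fun t => t ^+ N)).
      refine (@continuousD R R _ (fun=> 1) (@enorm R d) x _ _).
        exact: cst_continuous.
      exact: enorm_continuous.
    exact: (@exprn_continuous R N).
  have [B [_ hB]] : bounded_set (w s @` fsupp psi).
    by apply: compact_bounded; apply: continuous_compact cpsi;
       exact: continuous_subspaceT.
  exists `|B + 1|; split=> // x.
  have [/(imageP (w s))wx|nx] := pselect (fsupp psi x).
    apply: le_trans (ler_norm _) (le_trans (hB (B + 1) _ _ wx) (ler_norm _)).
    by rewrite ltrDl.
  rewrite /w (partial_eq0 s nx) /cmod /= expr0n /= addr0 sqrtr0 mulr0.
  exact: normr_ge0.
have [B hB] := choice w_bounded.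
exists (\sum_(k < N.+1) \sum_(t : k.-tuple 'I_d) B t) => s x sN.
apply: le_trans ((hB s).2 x) _.
have sN' : (size s < N.+1)%N by [].
rewrite (bigD1 (Ordinal sN')) //= (bigD1 (in_tuple s)) //= -addrA lerDl.
rewrite addr_ge0 //; first by apply: sumr_ge0 => t _; exact: (hB _).1.
by apply: sumr_ge0 => k _; apply: sumr_ge0 => t _; exact: (hB _).1.
Qed.

End SmoothFunctions.

(** * Support and scaling equation *)

Section SupportOfTheLimitFunction.
Set Implicit Arguments.
Unset Strict Implicit.
Context {R : realType} {d : nat}.
Implicit Types (M : 'M[int]_d) (c : 'cV[int]_d -> R[i]).

(** A singular matrix has the eigenvalue 0, which is not of modulus larger
    than 1. *)
Lemma dilation_matrix_unitmx M :
  dilation_matrix R M -> (map_mx intr M : 'M[R]_d) \in unitmx.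
Proof.
move=> dM; rewrite unitmxE unitfE det_map_mx intr_eq0.
apply/negP => /eqP detM.
suff /dM : eigenvalue (map_mx intr M : 'M[R[i]]_d) 0.
  by rewrite normr0 ltr10.
have /det0P[v v0 vM] : \det (map_mx intr M : 'M[R[i]]_d) == 0.
  by rewrite det_map_mx detM.
by apply/eigenvalueP; exists v => //; rewrite vM scale0r.
Qed.

Lemma dsupp_notin (T : @functional R d) x :
  ~ dsupp T x -> exists2 U, open U /\ vanishes_on T U & U x.
Proof. by move=> /contrapT[U [oU vU] Ux]; exists U. Qed.

(** Tested against [psi], the scaling equation is a finite sum of values of
    [phi] at the functions [y |-> psi (M^-1 (y + q))], whose supports are the
    images of [supp psi] under [y |-> M y - q]. So if [phi] vanishes near each
    of the finitely many points [M x - q], then it vanishes near [x]. *)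
Lemma dsupp_scaling_equation M c (phi : @functional R d) x :
  let MR : 'M[R]_d := map_mx intr M in
  MR \in unitmx -> finite_set (mask_support c) -> scaling_equation M c phi ->
  dsupp phi x ->
  exists2 q, mask_support c q & dsupp phi (MR *m x - map_mx intr q).
Proof.
move=> MR uM fc se Kx; apply: contrapT => nK.
have hU q : exists U : set 'cV[R]_d, mask_support c q ->
    [/\ open U, vanishes_on phi U & U (MR *m x - map_mx intr q)].
  have [cq|] := pselect (mask_support c q); last by exists set0.
  have /dsupp_notin[U [oU vU] Ux] : ~ dsupp phi (MR *m x - map_mx intr q).
    by move=> Kq; apply: nK; exists q.
  by exists U.
have {hU} [U hU] := choice hU.
pose h (q : 'cV[int]_d) (y : 'cV[R]_d) := MR *m y - map_mx intr q.
have h_cont q : continuous (h q).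
  have -> : h q = fun y => MR *m (y + invmx MR *m - map_mx intr q).
    by apply/funext => y; rewrite /h mulmxDr mulKVmx.
  exact: affine_continuous.
apply: Kx.
(* a neighbourhood of [x] because the mask has finite support *)
exists (\bigcap_(q in mask_support c) (h q @^-1` U q)); last first.
  by move=> q /hU[].
split.
  rewrite -closedC setC_bigcap; apply: closed_bigcup => // q /hU[oU _ _].
  apply: open_closedC; apply: open_comp oU => y _; exact: h_cont.
move=> psi tpsi sub.
rewrite (se psi (test_function_schwartz tpsi)) fsbig1 ?mulr0 // => q _.
have [->|cq] := eqVneq (c q) 0; first by rewrite mul0r.
have [_ vU _] := hU q cq.
rewrite /affine_pullback vU ?mulr0 //.
  by apply: test_function_affine; rewrite ?unitmx_inv.
move=> y /fsupp_affine /sub /(_ q cq) /=.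
by rewrite /h mulKVmx // addrK.
Qed.

Lemma le_mask_radius c q : finite_set (mask_support c) -> mask_support c q ->
  enorm (map_mx intr q : 'cV[R]_d) <= mask_radius c.
Proof.
move=> fc cq.
apply: (le_bigmax_seq 0 q xpredT (fun q => enorm (map_mx intr q : 'cV[R]_d))) => //.
by rewrite in_fset_set // inE.
Qed.

End SupportOfTheLimitFunction.

Theorem theorem3 (R : realType) (d : nat) (M : 'M[int]_d)
    (c : 'cV[int]_d -> R[i]) (phi : @functional R d) :
  let Minv : 'M[R]_d := invmx (map_mx intr M) in
  (0 < d)%N ->
  dilation_matrix R M ->
  opnorm Minv < 1 ->
  finite_set (mask_support c) ->
  \sum_(q \in [set: 'cV[int]_d]) c q = 1 ->
  limit_function M c phi ->
  dsupp phi `<=`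
    [set x | enorm x <= mask_radius c * opnorm Minv / (1 - opnorm Minv)].
Proof.
move=> Minv _ dM nu1 fc _ [_ cK se _] x Kx /=.
have uM := dilation_matrix_unitmx dM.
(* [x0] is a point of the support at the greatest distance from the origin *)
have [x0 /set_mem Kx0 x0max] : exists2 x0, x0 \in dsupp phi &
    forall t, t \in dsupp phi -> enorm t <= enorm x0.
  apply: compact_EVT_max => //; first by exists x.
  exact/continuous_subspaceT/enorm_continuous.
apply: le_trans (x0max x (mem_set Kx)) _.
have [q cq Kq] := dsupp_scaling_equation uM fc se Kx0.
set y := _ - _ in Kq.
have x0E : x0 = Minv *m (y + map_mx intr q) by rewrite subrK mulKmx.
rewrite ler_pdivlMr ?subr_gt0 //.
suff : enorm x0 <= opnorm Minv * (enorm x0 + mask_radius c) by lra.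
rewrite {1}x0E; apply: le_trans (enorm_mulmx _ _) _.
apply: (ler_wpM2l (opnorm_ge0 _)).
apply: le_trans (enormD _ _) (lerD (x0max y (mem_set Kq)) _).
exact: le_mask_radius.
Qed.
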